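(* Let $F:\mathbb{R}^+\to\mathbb{R}$ be a function, and let $(L(t),M(t))$ be a solution of the generalized finite relativistic Toda lattice $$\dot L=\bigl(F(LM^{-1})\bigr)_-L-L\bigl(F(M^{-1}L)\bigr)_-,\qquad \dot M=\bigl(F(LM^{-1})\bigr)_-M-M\bigl(F(M^{-1}L)\bigr)_-$$ with positive initial data $a_n(0)>0$, $b_n(0)>0$. Then the eigenvalues $\lambda_1<\cdots<\lambda_N$ of the generalized eigenvalue problem $L\vec x=\lambda M\vec x$ of the pair $(L,M)=(L(t),M(t))$ are constants of motion, that is, $\dot\lambda_j=0$ for $1\le j\le N$.
   Context: $\mathbb{R}^+=(0,\infty)$. For matrix data $a_1,\ldots,a_N>0$ and $b_1,\ldots,b_{N-1}>0$ (functions of $t$), $L$ is the $N\times N$ upper bidiagonal matrix with $L_{n,n}=a_n$, $L_{n,n+1}=1$, all other entries $0$; $M$ is the $N\times N$ lower bidiagonal matrix with $M_{n,n}=1$, $M_{n+1,n}=-b_n$, all other entries $0$. Solutions are taken with $a_n(t)>0$, $b_n(t)>0$ on the time interval considered. For a square matrix $X$, $X_-$ denotes its strictly lower triangular part. The generalized eigenvalue problem $L\vec x=\lambda M\vec x$ has $N$ distinct positive eigenvalues $\lambda_1<\cdots<\lambda_N$ (the zeros of $\det(zM-L)$), which are also the eigenvalues of the diagonalizable matrices $LM^{-1}$ and $M^{-1}L$. For a diagonalizable matrix $X=S\,\mathrm{diag}(\lambda_1,\ldots,\lambda_N)S^{-1}$ with positive eigenvalues, $F(X)=S\,\mathrm{diag}(F(\lambda_1),\ldots,F(\lambda_N))S^{-1}$.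 *)

(* Defs.v *)
From mathcomp Require Import all_boot all_order all_algebra.
From mathcomp Require Import all_classical all_reals all_analysis.
Import Order.TTheory GRing.Theory Num.Theory.
Import numFieldNormedType.Exports.

Set Implicit Arguments.
Unset Strict Implicit.
Unset Printing Implicit Defensive.

Local Open Scope classical_set_scope.
Local Open Scope ring_scope.

(* Row and column indices start at 0, so the classical a_1, ..., a_N and       *)
(* b_1, ..., b_(N-1) are a 0, ..., a (N-1) and b 0, ..., b (N-2); the other    *)
(* values of a and b are not used.                                             *)
Definition Lmx (R : realType) (N : nat) (a : nat -> R) : 'M[R]_N :=
  \matrix_(i, j) (if i == j then a i
                  else if j == i.+1 :> nat then 1 else 0).

Definition Mmx (R : realType) (N : nat) (b : nat -> R) : 'M[R]_N :=
  \matrix_(i, j) (if i == j then 1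
                  else if i == j.+1 :> nat then - b j else 0).

Definition strict_lower (R : realType) (N : nat) (X : 'M[R]_N) : 'M[R]_N :=
  \matrix_(i, j) (if (j < i)%N then X i j else 0).

Definition is_mxfun (R : realType) (N : nat) (F : {posnum R} -> R)
    (X Y : 'M[R]_N) : Prop :=
  exists (S : 'M[R]_N) (d : 'I_N -> {posnum R}),
    [/\ S \in unitmx,
        X = S *m diag_mx (\row_i (d i)%:num) *m invmx S &
        Y = S *m diag_mx (\row_i F (d i)) *m invmx S].

(* F(X); by mxfunE below the value does not depend on the diagonalization.     *)
(* It is 0 when X is not diagonalizable with positive eigenvalues.             *)
Definition mxfun (R : realType) (N : nat) (F : {posnum R} -> R)
    (X : 'M[R]_N) : 'M[R]_N :=
  xget 0 [set Y | is_mxfun F X Y].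

Lemma is_mxfun_uniq (R : realType) (N : nat) (F : {posnum R} -> R)
    (X Y Z : 'M[R]_N) : is_mxfun F X Y -> is_mxfun F X Z -> Y = Z.
Proof.
move=> [S [d [Su XS ->]]] [T [e [Tu XT ->]]].
pose P := invmx T *m S.
have TP : T *m P = S by rewrite /P mulmxA mulmxV // mul1mx.
have PD : P *m diag_mx (\row_i (d i)%:num) = diag_mx (\row_i (e i)%:num) *m P.
  have : X *m S = T *m diag_mx (\row_i (e i)%:num) *m P.
    by rewrite XT /P !mulmxA.
  rewrite {1}XS mulmxKV // -{1}TP -!mulmxA.
  by move/(congr1 (mulmx (invmx T))); rewrite !mulmxA mulVmx // !mul1mx.
have PF : P *m diag_mx (\row_i F (d i)) = diag_mx (\row_i F (e i)) *m P.
  apply/matrixP => i j; move/matrixP: PD => /(_ i j).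
  rewrite !mul_mx_diag !mul_diag_mx; move: (P) => Q; rewrite !mxE => PD.
  have [->|Q0] := eqVneq (Q i j) 0; first by rewrite mul0r mulr0.
  rewrite [RHS]mulrC; congr (_ * F _); apply: val_inj => /=.
  by apply: (mulfI Q0); rewrite PD mulrC.
by rewrite -{1}TP -[X in X *m invmx S]mulmxA PF -!mulmxA mulmxV // mulmx1.
Qed.

Lemma mxfunE (R : realType) (N : nat) (F : {posnum R} -> R) (S : 'M[R]_N)
    (d : 'I_N -> {posnum R}) : S \in unitmx ->
  mxfun F (S *m diag_mx (\row_i (d i)%:num) *m invmx S) =
  S *m diag_mx (\row_i F (d i)) *m invmx S.
Proof.
move=> Su; set X := S *m _ *m _; set Y := RHS.
have XY : is_mxfun F X Y by exists S, d.
apply: (@is_mxfun_uniq _ _ F X) (XY).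
by rewrite /mxfun; apply: (@xgetPex _ 0 [set Y | is_mxfun F X Y]); exists Y.
Qed.

(* Derivative relative to J: the usual derivative at interior points of J and  *)
(* the one-sided derivative at endpoints belonging to J.                       *)
Definition has_deriv_within (R : realType) (J : set R) (f : R -> R) (t l : R) :=
  (f s - f t) / (s - t) @[s --> within J (dnbhs t)] --> l.

Definition mx_has_deriv_within (R : realType) (N : nat) (J : set R)
    (A : R -> 'M[R]_N) (t : R) (A' : 'M[R]_N) : Prop :=
  forall i j, has_deriv_within J (fun s => A s i j) t (A' i j).

Definition rel_toda_solution (R : realType) (N : nat) (F : {posnum R} -> R)
    (J : set R) (L M : R -> 'M[R]_N) : Prop :=
  forall t, J t ->
    let A := strict_lower (mxfun F (L t *m invmx (M t))) in
    let B := strict_lower (mxfun F (invmx (M t) *m L t)) in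
    mx_has_deriv_within J L t (A *m L t - L t *m B) /\
    mx_has_deriv_within J M t (A *m M t - M t *m B).

Definition gen_eigenvalue (R : realType) (N : nat) (L M : 'M[R]_N) (z : R) :=
  exists2 x : 'cV[R]_N, x != 0 & L *m x = z *: (M *m x).

Definition gen_spectrum (R : realType) (N : nat) (L M : 'M[R]_N)
    (lam : 'I_N -> R) : Prop :=
  (forall i j : 'I_N, (i < j)%N -> lam i < lam j) /\
  (forall z, gen_eigenvalue L M z <-> exists j, z = lam j).

(* Main.v *)
Require Import Defs.
From mathcomp Require Import all_boot all_order all_algebra.
From mathcomp Require Import all_classical all_reals all_analysis.
From mathcomp Require Import perm ring.
Import Order.TTheory GRing.Theory Num.Theory.
Import numFieldNormedType.Exports.

Set Implicit Arguments.
Unset Strict Implicit.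
Unset Printing Implicit Defensive.

Local Open Scope classical_set_scope.
Local Open Scope ring_scope.

(* Write P(s) = z M(s) - L(s). The flow gives P' = A P - P B with A and B      *)
(* strictly lower triangular, so Jacobi's formula yields                       *)
(* (det P)' = tr (P' adj P) = (tr A - tr B) det P = 0. Hence the polynomial    *)
(* det (z M - L) does not depend on time, nor does its ordered list of zeros.  *)

(** The equations for L and M involve the same A and B, so by linearity every P = z M - L obeys the
    same law. [has_deriv_within_det] is Jacobi's formula and [has_deriv_within_det_lax] the
    cancellation of traces; the strictly lower triangular A and B have trace 0. By
    [has_deriv_within0_const], a mean value argument on J, det (z M - L) is constant in time for
    each fixed z. By [gen_eigenvalueP] the set of eigenvalues is then constant too, and by
    [gen_spectrum_uniq] so is its increasing enumeration. Each eigenvalue is thus constant on J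
    before it is differentiated, and no perturbation theory of roots enters. *)

Section DerivWithin.
Context {R : realType}.
Implicit Types (J : set R) (f g : R -> R) (t l m c : R).

Lemma has_deriv_within_eq J f g t l :
  f =1 g -> has_deriv_within J f t l -> has_deriv_within J g t l.
Proof. by move=> /funext ->. Qed.

Lemma has_deriv_within_cst J c t : has_deriv_within J (fun=> c) t 0.
Proof.
rewrite /has_deriv_within; under eq_fun do rewrite subrr mul0r.
exact: cvg_cst.
Qed.

Lemma has_deriv_withinD J f g t l m :
  has_deriv_within J f t l -> has_deriv_within J g t m ->
  has_deriv_within J (fun s => f s + g s) t (l + m).
Proof.
rewrite /has_deriv_within => fl gm.
under eq_fun do rewrite opprD addrACA mulrDl.
exact: cvgD.
Qed.

Lemma has_deriv_withinZ J f c t l :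
  has_deriv_within J f t l -> has_deriv_within J (fun s => c * f s) t (c * l).
Proof.
rewrite /has_deriv_within => fl.
under eq_fun do rewrite -mulrBr -mulrA.
by apply: cvgM => //; exact: cvg_cst.
Qed.

Lemma has_deriv_within_cvg J f t l :
  has_deriv_within J f t l -> f s @[s --> within J (dnbhs t)] --> f t.
Proof.
move=> fl.
have st0 : (s - t) @[s --> within J (dnbhs t)] --> (0 : R).
  rewrite -[X in _ --> X](subrr t); apply: cvg_within_filter.
  apply/(continuous_withinNx (fun s => s - t)).
  by apply: cvgB; [exact: cvg_id | exact: cvg_cst].
have : (f s - f t) / (s - t) * (s - t) + f t
    @[s --> within J (dnbhs t)] --> l * 0 + f t.
  by apply: cvgD; [exact: (cvgM fl st0) | exact: cvg_cst].
rewrite mulr0 add0r; apply: cvg_trans; apply: near_eq_cvg.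
rewrite near_withinE; near=> s => _ /=.
rewrite divfK ?subrK // subr_eq0.
by near: s; exact: nbhs_dnbhs_neq.
Unshelve. all: by end_near. Qed.

Lemma has_deriv_withinM J f g t l m :
  has_deriv_within J f t l -> has_deriv_within J g t m ->
  has_deriv_within J (fun s => f s * g s) t (l * g t + f t * m).
Proof.
move=> fl gm; rewrite /has_deriv_within.
(* The second term carries f at the moving point s, so its limit uses the continuity of f at t along
   J. *)
have -> : (fun s => (f s * g s - f t * g t) / (s - t)) =
    (fun s => (f s - f t) / (s - t) * g t + f s * ((g s - g t) / (s - t))).
  by apply/funext => s; ring.
apply: cvgD; first by apply: cvgM => //; exact: cvg_cst.
apply: cvgM gm; exact: has_deriv_within_cvg fl.
Qed.

Lemma has_deriv_within_sum J (I : Type) (r : seq I) (f : I -> R -> R)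
    (l : I -> R) t :
  (forall i, has_deriv_within J (f i) t (l i)) ->
  has_deriv_within J (fun s => \sum_(i <- r) f i s) t (\sum_(i <- r) l i).
Proof.
move=> fl; elim: r => [|i r IH].
  rewrite big_nil; apply: has_deriv_within_eq (has_deriv_within_cst J 0 t).
  by move=> s; rewrite big_nil.
rewrite big_cons; apply: has_deriv_within_eq (has_deriv_withinD (fl i) IH).
by move=> s; rewrite big_cons.
Qed.

(** Leibniz rule in which each summand keeps a product over all of r; for a determinant these are
    the terms with row k replaced. Since r is [uniq], the test [i == k] marks exactly one factor. *)
Lemma has_deriv_within_prod J (I : eqType) (r : seq I) (f : I -> R -> R)
    (l : I -> R) t : uniq r ->
  (forall i, has_deriv_within J (f i) t (l i)) ->
  has_deriv_within J (fun s => \prod_(i <- r) f i s) t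
    (\sum_(k <- r) \prod_(i <- r) (if i == k then l i else f i t)).
Proof.
move=> + fl; elim: r => [_|i r IH /= /andP[ir /IH {}IH]].
  rewrite big_nil; apply: has_deriv_within_eq (has_deriv_within_cst J 1 t).
  by move=> s; rewrite big_nil.
have neq k : k \in r -> (k == i = false) * (i == k = false).
  by move=> kr; split; apply: contraNF ir => /eqP; [move<- | move->].
rewrite big_cons big_cons eqxx.
under eq_big_seq => k kr do rewrite (neq k kr).1.
under [X in _ + X]eq_big_seq => k kr do rewrite big_cons (neq k kr).2.
rewrite -mulr_sumr; apply: has_deriv_within_eq (has_deriv_withinM (fl i) IH).
by move=> s; rewrite big_cons.
Qed.

(** The mean value theorem on [s, t], contained in J by convexity, needs a two-sided derivative only
    at interior points, where J is a neighbourhood. At s and t continuity along J suffices. *)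
Lemma has_deriv_within0_const (J : interval R) f :
  (forall t, t \in J -> has_deriv_within [set` J] f t 0) ->
  {in J &, forall s t, f s = f t}.
Proof.
move=> f0 s t.
wlog st : s t / s < t => [H sJ tJ|sJ tJ].
  by have [/H->|/H->|->] // := ltgtP s t.
have subJ x : x \in `[s, t] -> x \in J.
  by move=> xst; apply: (interval_is_interval sJ tJ); rewrite ?(itvP xst).
have [x xst||c _] := @MVT R f (fun=> 0) s t st.
- apply/is_derive1_caratheodory.
  (* Carathéodory's slope function, completed at x by the expected derivative 0. *)
  exists (fun z => if z == x then 0 else (f z - f x) / (z - x)).
  rewrite eqxx; split=> // [z|].
    have [->|zx] := eqVneq z x; first by rewrite !subrr mulr0.
    by rewrite divfK // subr_eq0.
  apply/continuous_withinNx; rewrite eqxx.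
  have xJ : x \in J by apply/subJ/subset_itv_oo_cc.
  move: (f0 x xJ); rewrite /has_deriv_within => H.
  apply: cvg_trans.
    apply: near_eq_cvg; near=> z.
    have zx : z != x by near: z; exact: nbhs_dnbhs_neq.
    by rewrite (negbTE zx); reflexivity.
  move=> U /H.
  rewrite [X in X -> _]/(\forall z \near x^',
    z \in J -> U ((f z - f x) / (z - x))) => HU.
  have nJ : \forall z \near x^', z \in J.
    apply: nbhs_dnbhs; near=> z; apply/subJ/subset_itv_oo_cc.
    by near: z; exact: near_in_itvoo.
  by apply: filterS2 HU nJ => z HUz zJ; exact: HUz.
- apply/subspace_continuousP => x /= /subJ xJ U.
  move=> /[dup] /nbhs_singleton Ufx /(has_deriv_within_cvg (f0 x xJ)).
  rewrite [X in X -> _]/(\forall z \near x, z != x -> z \in J -> U (f z)).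
  rewrite -[X in _ -> X]/(\forall z \near x, z \in `[s, t] -> U (f z)).
  apply: filterS => z Uz /subJ zJ.
  by have [->//|zx] := eqVneq z x; exact: Uz.
- by rewrite mul0r => /eqP; rewrite subr_eq0 => /eqP.
Unshelve. all: by end_near. Qed.

End DerivWithin.

(** Jacobi's formula: differentiate the Leibniz expansion, then collect the terms where the factor
    from row k is differentiated. *)
Lemma has_deriv_within_det (R : realType) (N : nat) (J : set R)
    (P : R -> 'M[R]_N) (t : R) (P' : 'M[R]_N) :
  mx_has_deriv_within J P t P' ->
  has_deriv_within J (fun s => \det (P s)) t (\tr (P' *m \adj (P t))).
Proof.
move=> dP; have -> : \tr (P' *m \adj (P t)) = \sum_(s : 'S_N) (-1) ^+ s *
    \sum_k \prod_i (if i == k then P' i (s i) else P t i (s i)).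
  under [RHS]eq_bigr do rewrite mulr_sumr.
  rewrite exchange_big /=; apply: eq_bigr => k _.
  (* Q differs from [P t] only in row k, so both have the same cofactors along that row, and
     expanding [\det Q] there gives the k-th diagonal entry of [P' *m \adj (P t)]. *)
  pose Q := \matrix_(i, j) (if i == k then P' i j else P t i j).
  transitivity (\det Q).
    rewrite (expand_det_row _ k) !mxE; apply: eq_bigr => j _.
    rewrite !mxE eqxx; congr (_ * (_ * \det _)).
    by apply/matrixP => u v; rewrite !mxE eq_sym (negbTE (neq_lift _ _)).
  apply: eq_bigr => s _; congr (_ * _); apply: eq_bigr => i _.
  by rewrite mxE.
apply: (@has_deriv_within_sum _ _ _ _ (fun s u => _)) => s.
apply: has_deriv_withinZ.
by apply: has_deriv_within_prod; [exact: index_enum_uniq | move=> i].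
Qed.

Lemma mxtrace_strict_lower (R : realType) (N : nat) (X : 'M[R]_N) :
  \tr (strict_lower X) = 0.
Proof. by apply: big1 => i _; rewrite mxE ltnn. Qed.

(** By cyclicity of the trace, tr ((A P - P B) adj P) = (tr A - tr B) det P. The adjugate stands in
    for an inverse because z M - L is singular exactly when z is an eigenvalue. *)
Lemma has_deriv_within_det_lax (R : realType) (N : nat) (J : set R)
    (P : R -> 'M[R]_N) (A B : 'M[R]_N) (t : R) : \tr A = \tr B ->
  mx_has_deriv_within J P t (A *m P t - P t *m B) ->
  has_deriv_within J (fun s => \det (P s)) t 0.
Proof.
move=> AB /has_deriv_within_det; congr has_deriv_within.
rewrite mulmxBl -mulmxA mul_mx_adj raddfB /=.
rewrite [\tr (_ *m B *m _)]mxtrace_mulC mulmxA mul_adj_mx.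
by rewrite mul_mx_scalar mul_scalar_mx !mxtraceZ AB subrr.
Qed.

Lemma gen_eigenvalueP (R : realType) (N : nat) (L M : 'M[R]_N) (z : R) :
  gen_eigenvalue L M z <-> \det (z *: M - L) = 0.
Proof.
(* [det0P] speaks of row vectors in the left kernel, hence the transposes. *)
rewrite -det_tr; split=> [[x x0 Lx]|/eqP/det0P[v v0 vP]].
  apply/eqP/det0P; exists x^T; first by rewrite trmx_eq0.
  by rewrite -trmx_mul mulmxBl -scalemxAl Lx subrr trmx0.
exists v^T; first by rewrite trmx_eq0.
apply/esym/eqP; rewrite -subr_eq0 scalemxAl -mulmxBl -trmx_eq0 trmx_mul trmxK.
by rewrite vP.
Qed.

(** A strictly increasing list is determined by its set of members; here the lists are the codomains
    of [lam] and [mu]. *)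
Lemma gen_spectrum_uniq (R : realType) (N : nat) (L M L' M' : 'M[R]_N)
    (lam mu : 'I_N -> R) :
  (forall z, gen_eigenvalue L M z <-> gen_eigenvalue L' M' z) ->
  gen_spectrum L M lam -> gen_spectrum L' M' mu -> lam = mu.
Proof.
move=> LM [lam_lt lamP] [mu_lt muP].
have srt (f : 'I_N -> R) : (forall i j : 'I_N, (i < j)%N -> f i < f j) ->
    sorted <%O (codom f).
  move=> f_lt; apply: (homo_sorted f_lt).
  by have := iota_ltn_sorted 0 N; rewrite -val_enum_ord sorted_map.
have : codom lam = codom mu.
  apply: lt_sorted_eq; [exact: srt | exact: srt | move=> z].
  apply/codomP/codomP => [[i zi]|[i zi]].
    by apply/muP/LM/lamP; exists i.
  by apply/lamP/LM/muP; exists i.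
by move=> /eq_in_map lm; apply/funext => i; apply: lm; rewrite mem_enum.
Qed.

Theorem theorem3p5 (R : realType) (N : nat) (F : {posnum R} -> R)
    (J : interval R) (a b : R -> nat -> R)
    (J0 : 0 \in J)
    (a_gt0 : forall t n, t \in J -> (n < N)%N -> 0 < a t n)
    (b_gt0 : forall t n, t \in J -> (n.+1 < N)%N -> 0 < b t n)
    (sol : rel_toda_solution F [set` J]
             (fun t => Lmx N (a t)) (fun t => Mmx N (b t)))
    (lam : R -> 'I_N -> R)
    (lamP : forall t, t \in J -> gen_spectrum (Lmx N (a t)) (Mmx N (b t)) (lam t)) :
  forall (j : 'I_N) (t : R), t \in J ->
    has_deriv_within [set` J] (fun s => lam s j) t 0.
Proof.
have det_const z : {in J &, forall s t,
    \det (z *: Mmx N (b s) - Lmx N (a s)) =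
    \det (z *: Mmx N (b t) - Lmx N (a t))}.
  apply: has_deriv_within0_const => t tJ; have [] := sol t tJ.
  set A := strict_lower _; set B := strict_lower _ => dL dM.
  apply: (@has_deriv_within_det_lax _ _ _ _ A B).
    by rewrite !mxtrace_strict_lower.
  have -> : A *m (z *: Mmx N (b t) - Lmx N (a t)) -
      (z *: Mmx N (b t) - Lmx N (a t)) *m B =
      z *: (A *m Mmx N (b t) - Mmx N (b t) *m B) +
      (-1) *: (A *m Lmx N (a t) - Lmx N (a t) *m B).
    rewrite mulmxBr mulmxBl -scalemxAr -scalemxAl scalerBr scaleN1r !opprB.
    by rewrite [X in _ + X]addrC addrACA [X in _ + X = _]addrC.
  move=> i k; have := has_deriv_withinD (has_deriv_withinZ (c := z) (dM i k))
    (has_deriv_withinZ (c := -1) (dL i k)).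
  by congr has_deriv_within; [apply/funext => s|]; rewrite !mxE ?mulN1r.
have lam_const : {in J &, forall s t, lam s = lam t}.
  move=> s t sJ tJ; apply: gen_spectrum_uniq (lamP s sJ) (lamP t tJ) => z.
  by rewrite !gen_eigenvalueP (det_const z s t).
(* The difference quotient is identically 0 on J. *)
move=> j t tJ; apply: cvg_near_cst; rewrite near_withinE.
by apply: filterE => s sJ; rewrite (lam_const s t) // subrr mul0r.
Qed.
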